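(* There exists a constant $c>0$ such that for every $N\in\mathbb{N}$ and every $N$-element point set $\mathcal{P}$ in $[0,1)^2$ we have $L_{1,N}^{\mathrm{extr}}(\mathcal{P})\ge c\sqrt{\log N}$.
   Context: For an $N$-element point set $\mathcal{P}=\{\mathbf{x}_0,\dots,\mathbf{x}_{N-1}\}\subseteq[0,1)^2$ and a measurable $B\subseteq[0,1]^2$ let $A(B,\mathcal{P})=\#\{n:\mathbf{x}_n\in B\}$ and let $\lambda$ be Lebesgue measure. For $\mathbf{x}\le\mathbf{y}$ componentwise in $[0,1]^2$, $[\mathbf{x},\mathbf{y})=[x_1,y_1)\times[x_2,y_2)$. The extreme $L_1$ discrepancy is $$L_{1,N}^{\mathrm{extr}}(\mathcal{P})=\int_{[0,1]^2}\int_{[0,1]^2,\ \mathbf{x}\le\mathbf{y}}\big|A([\mathbf{x},\mathbf{y}),\mathcal{P})-N\lambda([\mathbf{x},\mathbf{y}))\big|\,d\mathbf{x}\,d\mathbf{y}.$$ *)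

(* Defs.v *)
From mathcomp Require Import all_boot all_order all_algebra.
From mathcomp Require Import all_classical all_reals all_analysis.
Set Implicit Arguments.
Unset Strict Implicit.
Unset Printing Implicit Defensive.
Import Order.TTheory GRing.Theory Num.Theory.
Import numFieldNormedType.Exports.
Local Open Scope classical_set_scope.
Local Open Scope ring_scope.

(* [measurableTypeR R] is [R] with the measurable structure that carries
   [lebesgue_measure]; it is used in the type so that integrals against
   [lambda2] are taken over that very structure. *)
Definition lambda2 (R : realType) :
    set (measurableTypeR R * measurableTypeR R) -> \bar R :=
  (@lebesgue_measure R \x @lebesgue_measure R)%E.

Definition box (R : realType) (x y : R * R) : set (R * R) :=
  `[x.1, y.1[ `*` `[x.2, y.2[.

Definition closed_unit_square (R : realType) : set (R * R) :=
  `[0, 1] `*` `[0, 1].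

Definition halfopen_unit_square (R : realType) : set (R * R) :=
  `[0, 1[ `*` `[0, 1[.

Definition lec (R : realType) (x y : R * R) : bool :=
  (x.1 <= y.1) && (x.2 <= y.2).

(* A(B, P) for the point set enumerated by p : 'I_N -> R * R *)
Definition count_in (R : realType) (N : nat) (p : 'I_N -> R * R)
    (B : set (R * R)) : nat :=
  #|[pred n | p n \in B]|.

(* The integrand is nonnegative, measurable and bounded by N, so the
   extended-real integral is the usual one and is finite. *)
Definition extr_L1_discrepancy (R : realType) (N : nat) (p : 'I_N -> R * R) :
    \bar R :=
  (\int[@lambda2 R]_(y in @closed_unit_square R)
     \int[@lambda2 R]_(x in
        [set x | @closed_unit_square R x /\ lec x y])
       `| (count_in p (box x y))%:R%:E - N%:R%:E * lambda2 (box x y) |)%E.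

(* Main.v *)
Require Import Defs.
From mathcomp Require Import all_boot all_order all_algebra.
From mathcomp Require Import all_classical all_reals all_analysis.
From mathcomp Require Import measurable_realfun ring lra zify.
Set Implicit Arguments.
Unset Strict Implicit.
Unset Printing Implicit Defensive.
Import Order.TTheory GRing.Theory Num.Theory.
Import numFieldNormedType.Exports.
Local Open Scope classical_set_scope.
Local Open Scope ring_scope.

(** For a fixed upper corner [y] in [1/2, 1)^2 the inner integral over
    [x] in [0, 1/2)^2 is already at least a constant times [sqrt (log N)]; this
    is Halász's argument for the star discrepancy in the variable [x].

    Take [2N <= 2^k <= 4N] and, on a fine grid in [0, 1/2)^2, the discrepancy
    [G (i, j) = N (y_1 - delta i) (y_2 - delta j) - #(points counted)].  For
    each [r <= k] let [f_r] be the sum of the Haar functions of the dyadic boxes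
    of type [2^-r x 2^-(k-r)] that contain no point.  A point outside a box
    contributes to [G] a product of thresholds one of which is constant on the
    box, so the Haar function of an empty box only sees the area term; at least
    half of the boxes are empty, whence [<G, f_r>] is of order [M^2] for a grid
    of [M^2] points.

    The test function is the imaginary part [B] of the Riesz product of
    [1 + i c f_r], [c = 1 / (8 sqrt (k + 1))], which is bounded.  Writing [C_r]
    for the real part of the product of the first [r] factors,
    [<G, B> = c \sum_r <G, f_r C_r>].  For fixed [i], [C_r] has average [1]
    over every block of [j] on which [f_0, ..., f_(r-1)] have completed their
    oscillations, so replacing [C_r] by [1] is a small error and
    [<G, B>] is at least of order [c (k + 1) M^2], i.e. [sqrt (k + 1) M^2].

    Finally the inner integral dominates that of a step function built from the
    grid values, the loss being [O(N / M)]. *)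

(** * Block sums and Haar waves along a line of grid points *)

Section BlockSums.
Variable R : realFieldType.
Implicit Types (phi psi : nat -> R) (l t a : nat).

Definition block_sum l t phi : R := \sum_(u < l) phi (t * l + u)%N.

(** On a block of length [2 * l] this is the Haar function: [1] on the first half, [-1] on the
    second. *)
Definition wave l (j : nat) : R := (-1) ^+ (j %/ l).

Lemma eq_block_sum l t phi psi :
  (forall u, (u < l)%N -> phi (t * l + u)%N = psi (t * l + u)%N) ->
  block_sum l t phi = block_sum l t psi.
Proof. by move=> eqp; apply: eq_bigr => u _; apply: eqp. Qed.

Lemma eq_block_sum_fun l t phi psi : phi =1 psi ->
  block_sum l t phi = block_sum l t psi.
Proof. by move=> eqp; apply: eq_block_sum => u _; apply: eqp. Qed.

Lemma block_sumD l t phi psi :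
  block_sum l t (fun j => phi j + psi j) = block_sum l t phi + block_sum l t psi.
Proof. exact: big_split. Qed.

Lemma block_sumZ l t c phi :
  block_sum l t (fun j => c * phi j) = c * block_sum l t phi.
Proof. by rewrite /block_sum mulr_sumr. Qed.

Lemma block_sumB l t phi psi :
  block_sum l t (fun j => phi j - psi j) = block_sum l t phi - block_sum l t psi.
Proof. by rewrite /block_sum sumrB. Qed.

Lemma block_sum_const l t c : block_sum l t (fun=> c) = c * l%:R.
Proof. by rewrite /block_sum sumr_const card_ord mulr_natr. Qed.

Lemma block_sum_double l t phi :
  block_sum (2 * l) t phi =
  block_sum l (2 * t) phi + block_sum l (2 * t).+1 phi.
Proof.
rewrite /block_sum mul2n -addnn big_split_ord /=; congr (_ + _);
  apply: eq_bigr => u _; congr phi; ring.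
Qed.

Lemma sum_blocks m T l phi : m = (T * l)%N ->
  \sum_(j < m) phi j = \sum_(t < T) block_sum l t phi.
Proof.
move=> ->; elim: T => [|T IH]; first by rewrite mul0n !big_ord0.
by rewrite mulSnr big_split_ord /= IH big_ord_recr.
Qed.

Lemma block_index l t u : (u < l)%N -> ((t * l + u) %/ l = t)%N.
Proof. by move=> ul; rewrite divnMDl ?(leq_ltn_trans _ ul)// divn_small ?addn0. Qed.

Lemma block_sum_wave l t phi :
  block_sum (2 * l) t (fun j => wave l j * phi j) =
  block_sum l (2 * t) phi - block_sum l (2 * t).+1 phi.
Proof.
have cst s : block_sum l s (fun j => wave l j * phi j) =
    (-1) ^+ s * block_sum l s phi.
  rewrite -block_sumZ; apply: eq_block_sum => u ul.
  by rewrite /wave block_index.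
rewrite block_sum_double !cst exprS exprM sqrrN expr1n expr1n.
by rewrite mul1r mulr1 mulN1r.
Qed.

(** Only the block containing [a] sees the threshold jump; on any other block both comparisons
    reduce to [t < a %/ l]. *)
Lemma threshold_const l t a u v : (a %/ l != t)%N -> (u < l)%N -> (v < l)%N ->
  ((t * l + u <= a) = (t * l + v <= a))%N.
Proof.
move=> at_ ul vl; have l0 : (0 < l)%N by apply: leq_ltn_trans ul.
have key w : (w < l)%N -> ((t * l + w <= a) = (t < a %/ l))%N.
  move=> wl; case: (ltngtP t (a %/ l)%N) => [ta|ta|ta].
  - apply: leq_trans (leq_trunc_div a l); apply: leq_trans (_ : t.+1 * l <= _)%N.
      by rewrite mulSn addnC leq_add2r ltnW.
    by rewrite leq_mul2r ta orbT.
  - apply/negbTE; rewrite -ltnNge; apply: leq_trans (leq_addr _ _).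
    by rewrite -ltn_divLR.
  - by rewrite ta eqxx in at_.
by rewrite !key.
Qed.

Lemma block_sum_threshold l t a phi : (a %/ l != t)%N ->
  block_sum l t phi = 0 ->
  block_sum l t (fun j => (j <= a)%N%:R * phi j) = 0.
Proof.
move=> at_ phi0; have [->|l0] := posnP l; first by rewrite /block_sum big_ord0.
rewrite -(mulr0 (t * l + 0 <= a)%N%:R) -phi0 -block_sumZ.
by apply: eq_block_sum => u ul; rewrite (threshold_const at_ ul l0).
Qed.

Lemma block_sum_shift l t phi :
  block_sum l t (fun j => j%:R * phi j) =
  (t * l)%:R * block_sum l t phi + \sum_(u < l) u%:R * phi (t * l + u)%N.
Proof.
rewrite /block_sum mulr_sumr -big_split /=.
by apply: eq_bigr => u _; rewrite natrD mulrDl.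
Qed.

Lemma wave_moment l t :
  block_sum (2 * l) t (fun j => wave l j * j%:R) = - (l%:R ^+ 2).
Proof.
rewrite block_sum_wave /block_sum -sumrB.
rewrite (eq_bigr (fun=> - l%:R)); last first.
  by move=> u _; rewrite [in X in _ - X]mulSn -addnA (natrD _ l) opprD addrCA subrr addr0.
by rewrite sumr_const card_ord -mulr_natr; ring.
Qed.

End BlockSums.

(** * Riesz products in one variable *)

Section Riesz.
Variables (R : realFieldType) (c : R) (e : nat).
Implicit Type g : nat -> nat -> R.

(** For fixed [i] this is f_q as a function of [j]. The offset [e] makes even the shortest half-wave
    2^e grid points long. *)
Definition riesz_factor g q j : R :=
  g q (j %/ (2 * 2 ^ (e + q)))%N * wave R (2 ^ (e + q)) j.

(* Imaginary and real part of the product over [q < r] of [1 + i c f_q (j)]. *)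
Fixpoint riesz g r j : R * R :=
  if r isn't q.+1 then (0, 1) else
  let f := c * riesz_factor g q j in
  ((riesz g q j).1 + f * (riesz g q j).2,
   (riesz g q j).2 - f * (riesz g q j).1).

Lemma eq_riesz g g' r j : (forall q t, (q < r)%N -> g q t = g' q t) ->
  riesz g r j = riesz g' r j.
Proof.
elim: r => //= r IH eqg; rewrite IH; last by move=> q t qr; apply: eqg; apply: ltnW.
by rewrite /riesz_factor eqg.
Qed.

Lemma riesz_im_sum g r j :
  (riesz g r j).1 = \sum_(q < r) c * riesz_factor g q j * (riesz g q j).2.
Proof. by elim: r => [|r IH]; rewrite ?big_ord0 // big_ord_recr /= IH. Qed.

(** On a block of doubled length the new factor has a constant coefficient and opposite signs on the
    two halves. By induction the earlier product has equal sums over these halves, so the new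
    contribution cancels. *)
Lemma riesz_averages g r t :
  block_sum (2 ^ (e + r)) t (fun j => (riesz g r j).1) = 0 /\
  block_sum (2 ^ (e + r)) t (fun j => (riesz g r j).2) = (2 ^ (e + r))%:R.
Proof.
elim: r t => [|r IH] t /=; first by rewrite !block_sum_const mul0r mul1r.
set l := (2 ^ (e + r))%N in IH *.
rewrite addnS expnS -/l.
have split phi :
    block_sum (2 * l) t (fun j => c * riesz_factor g r j * phi j) =
    c * g r t * (block_sum l (2 * t) phi - block_sum l (2 * t).+1 phi).
  rewrite -block_sum_wave -block_sumZ; apply: eq_block_sum => u ul.
  by rewrite /riesz_factor block_index// !mulrA.
split.
- rewrite block_sumD split block_sum_double.
  by rewrite !(IH _).1 !(IH _).2 subrr mulr0 !addr0.
- rewrite block_sumB split block_sum_double.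
  by rewrite !(IH _).1 !(IH _).2 subrr mulr0 subr0 natrM; ring.
Qed.

Hypothesis c0 : 0 <= c.

(** The squared modulus is the product of the factors 1 + c^2 f_q^2. Since 2 r c^2 stays at most 1,
    linear growth with slope 2 c^2 absorbs the cross term of each multiplication. *)
Lemma riesz_norm g n r j : (forall q t, `|g q t| <= 1) ->
  2 * n%:R * c ^+ 2 <= 1 -> (r <= n)%N ->
  (riesz g r j).1 ^+ 2 + (riesz g r j).2 ^+ 2 <= 1 + 2 * r%:R * c ^+ 2.
Proof.
move=> g1 nc; elim: r => [|r IH] rn /=; first by rewrite mulr0 mul0r expr0n/= expr1n; lra.
have := IH (ltnW rn); move: (riesz g r j) => [B C] /=.
set f := riesz_factor g r j.
have f1 : f ^+ 2 <= 1.
  rewrite /f /riesz_factor /wave exprMn sqrr_sign mulr1 -real_normK ?num_real//.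
  by rewrite expr_le1.
have rc : 2 * r%:R * c ^+ 2 <= 1.
  apply: le_trans nc; rewrite ler_wpM2r ?sqr_ge0// ler_pM2l ?ltr0n// ler_nat.
  exact: ltnW.
move=> BC.
have -> : (B + c * f * C) ^+ 2 + (C - c * f * B) ^+ 2 =
  (B ^+ 2 + C ^+ 2) * (1 + c ^+ 2 * f ^+ 2) by ring.
have c2 : 0 <= c ^+ 2 by apply: sqr_ge0.
apply: (@le_trans _ _ ((1 + 2 * r%:R * c ^+ 2) * (1 + c ^+ 2))).
  have BC0 : 0 <= B ^+ 2 + C ^+ 2 by rewrite addr_ge0 ?sqr_ge0.
  have cf0 : 0 <= 1 + c ^+ 2 * f ^+ 2 by apply: addr_ge0 => //; apply: mulr_ge0 => //; apply: sqr_ge0.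
  by apply: ler_pM => //; rewrite lerD2l ler_piMr.
rewrite -natr1; nra.
Qed.

Lemma riesz_im_le g n r j : (forall q t, `|g q t| <= 1) ->
  2 * n%:R * c ^+ 2 <= 1 -> (r <= n)%N -> `|(riesz g r j).1| <= 2.
Proof.
move=> g1 nc rn; have := riesz_norm j g1 nc rn.
have : 2 * r%:R * c ^+ 2 <= 1.
  apply: le_trans nc; rewrite ler_wpM2r ?sqr_ge0// ler_pM2l ?ltr0n// ler_nat.
  by [].
move: (riesz g r j) => [B C] /= h1 h2.
rewrite -[2]ger0_norm// -ler_sqr ?nnegrE// !real_normK ?num_real//.
have := sqr_ge0 C; lra.
Qed.

(** The imaginary part has sum zero over the block, so [j] may be measured from the start of the
    block. *)
Lemma riesz_im_moment g n r t : (forall q t, `|g q t| <= 1) ->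
  2 * n%:R * c ^+ 2 <= 1 -> (r <= n)%N ->
  `|block_sum (2 ^ (e + r)) t (fun j => j%:R * (riesz g r j).1)| <=
    2 * (2 ^ (e + r))%:R ^+ 2.
Proof.
move=> g1 nc rn; rewrite block_sum_shift (riesz_averages _ _ _).1 mulr0 add0r.
set l := (2 ^ (e + r))%N.
apply: le_trans (ler_norm_sum _ _ _) _.
apply: le_trans (_ : \sum_(u < l) (2 * l%:R) <= _); last first.
  by rewrite sumr_const card_ord -mulr_natr; lra.
apply: ler_sum => u _; rewrite normrM mulrC ler_pM ?(riesz_im_le _ g1 nc)//.
by rewrite normr_nat ler_nat ltnW.
Qed.

(** Passing from length l to 2 l turns an error E into at most 2 E + 4 c l^2, the last term coming
    from the imaginary parts; the bound 2 c l^2 reproduces itself exactly under this recursion. *)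
Lemma riesz_re_moment g n r t : (forall q t, `|g q t| <= 1) ->
  2 * n%:R * c ^+ 2 <= 1 -> (r <= n)%N ->
  `|block_sum (2 ^ (e + r)) t (fun j => j%:R * ((riesz g r j).2 - 1))| <=
    2 * c * (2 ^ (e + r))%:R ^+ 2.
Proof.
move=> g1 nc; elim: r t => [|r IH] t rn /=.
  rewrite (_ : block_sum _ _ _ = 0) ?normr0 ?mulr_ge0 ?sqr_ge0//.
  by rewrite /block_sum big1// => u _; rewrite subrr mulr0.
have := (riesz_im_moment (2 * t) g1 nc (ltnW rn),
  riesz_im_moment (2 * t).+1 g1 nc (ltnW rn)).
have := (IH (2 * t)%N (ltnW rn), IH (2 * t).+1 (ltnW rn)).
set l := (2 ^ (e + r))%N; rewrite addnS expnS -/l.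
set E1 := block_sum _ _ _; set E2 := block_sum _ _ _.
set F1 := block_sum _ _ _; set F2 := block_sum _ _ _.
move=> [E1l E2l] [F1l F2l].
have -> : block_sum (2 * l) t (fun j => j%:R *
    ((riesz g r j).2 - c * riesz_factor g r j * (riesz g r j).1 - 1)) =
    (E1 + E2) - c * g r t * (F1 - F2).
  rewrite -block_sum_double -block_sum_wave -block_sumZ -block_sumB.
  apply: eq_block_sum => u ul.
  by rewrite /riesz_factor block_index//; ring.
rewrite natrM exprMn.
apply: le_trans (ler_normB _ _) _; rewrite !normrM (ger0_norm c0).
have := ler_normD E1 E2; have := ler_normB F1 F2; have := g1 r t.
have := normr_ge0 (g r t).
move: `|g r t| => G G0 G1 FF EE.
have : c * G * `|F1 - F2| <= c * (4 * l%:R ^+ 2).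
  rewrite -mulrA ler_wpM2l//; apply: le_trans (_ : `|F1 - F2| <= _); last by lra.
  by rewrite ler_piMl.
lra.
Qed.

(** With [1] in place of the real part the value is -l^2. Each half adds an error of at most 2 c
    l^2, in total at most l^2 / 2 because c <= 1/8. *)
Lemma riesz_wave_moment g n r t : (forall q t, `|g q t| <= 1) ->
  2 * n%:R * c ^+ 2 <= 1 -> c <= 8^-1 -> (r <= n)%N ->
  block_sum (2 * 2 ^ (e + r)) t
    (fun j => wave R (2 ^ (e + r)) j * (j%:R * (riesz g r j).2)) <=
  - ((2 ^ (e + r))%:R ^+ 2 / 2).
Proof.
move=> g1 nc c8 rn.
have := (riesz_re_moment (2 * t) g1 nc rn, riesz_re_moment (2 * t).+1 g1 nc rn).
have := wave_moment R (2 ^ (e + r)) t.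
set l := (2 ^ (e + r))%N => W.
set E1 := block_sum _ _ _; set E2 := block_sum _ _ _ => -[E1l E2l].
have -> : block_sum (2 * l) t (fun j => wave R l j * (j%:R * (riesz g r j).2)) =
    - l%:R ^+ 2 + (E1 - E2).
  rewrite -W -block_sum_wave -block_sumD; apply: eq_block_sum => u ul.
  by ring.
have : c * l%:R ^+ 2 <= 8^-1 * l%:R ^+ 2 by rewrite ler_wpM2r ?sqr_ge0.
move: E1l E2l; rewrite !ler_norml => /andP[_ ?] /andP[? _]; lra.
Qed.

Lemma riesz_wave0 g r t :
  block_sum (2 * 2 ^ (e + r)) t
    (fun j => wave R (2 ^ (e + r)) j * (riesz g r j).2) = 0.
Proof. by rewrite block_sum_wave !(riesz_averages _ _ _).2 subrr. Qed.

End Riesz.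

(** * The grid discrepancy tested against the Riesz product *)

Section Grid.
Variables (R : realFieldType) (N k e : nat) (a b : 'I_N -> nat).
Variables (w : 'I_N -> R) (alpha beta delta c : R).

Let lx r := (2 ^ (e + (k - r)))%N.
Let ly r := (2 ^ (e + r))%N.
Let M := (2 ^ (e + k).+1)%N.

Definition grid_discrepancy (i j : nat) : R :=
  N%:R * ((alpha - delta * i%:R) * (beta - delta * j%:R)) -
  \sum_n w n * ((i <= a n)%N%:R * (j <= b n)%N%:R).

Definition empty_box r s t : bool :=
  [forall n, ~~ ((a n %/ (2 * lx r) == s)%N && (b n %/ (2 * ly r) == t)%N)].

(* The coefficient of [wave (ly q) j] in [f_q (i, j)]: absorbing the wave in [i]
   makes the Riesz product, for fixed [i], a one-dimensional one in [j]. *)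
Definition box_sign i q t : R :=
  (empty_box q (i %/ (2 * lx q))%N t)%:R * wave R (lx q) i.

Lemma box_sign_le1 i q t : `|box_sign i q t| <= 1.
Proof. by rewrite normrM normr_sign mulr1; case: empty_box; rewrite ?normr1 ?normr0. Qed.

(** For q < r the length [2 * lx r] divides [lx q]: in [i] the earlier levels are coarser and cannot
    change within a box of level [r]. On such a box C_r therefore depends on [j] alone. *)
Lemma box_sign_block r s u q t : (r <= k)%N -> (q < r)%N -> (u < 2 * lx r)%N ->
  box_sign (s * (2 * lx r) + u)%N q t = box_sign (s * (2 * lx r))%N q t.
Proof.
move=> rk qr ur.
have lxq : lx q = (2 * lx r * 2 ^ (r - q.+1))%N.
  by rewrite /lx -expnS -expnD; congr (2 ^ _)%N; lia.
have lx2q : (2 * lx q)%N = (2 * lx r * (2 ^ (r - q.+1) * 2))%N.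
  by rewrite mulnA -lxq mulnC.
have lr0 : (0 < 2 * lx r)%N by apply: leq_ltn_trans ur.
have key m : ((s * (2 * lx r) + u) %/ (2 * lx r * m) =
              s * (2 * lx r) %/ (2 * lx r * m))%N.
  by rewrite !(divnMA _ (2 * lx r)) block_index// mulnK.
by rewrite /box_sign /wave lx2q lxq !key.
Qed.

Let C r i := fun j => (riesz c e (box_sign i) r j).2.

Lemma riesz_box_block r s u j : (r <= k)%N -> (u < 2 * lx r)%N ->
  C r (s * (2 * lx r) + u) j = C r (s * (2 * lx r)) j.
Proof.
by move=> rk ur; rewrite /C (@eq_riesz _ _ _ _ (box_sign (s * (2 * lx r))))// => q t qr;
  rewrite box_sign_block.
Qed.

Lemma block_sum_separate l l' s t (phi psi : nat -> R) :
  block_sum l s (fun i => block_sum l' t (fun j => phi i * psi j)) =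
  block_sum l s phi * block_sum l' t psi.
Proof.
rewrite mulrC -block_sumZ; apply: eq_block_sum => u _.
by rewrite block_sumZ mulrC.
Qed.

Lemma block_sum_bigsum l s (I : finType) (F : I -> nat -> R) :
  block_sum l s (fun i => \sum_n F n i) = \sum_n block_sum l s (F n).
Proof. exact: exchange_big. Qed.

(** On the box the test function is a product of a function of [i] and one of [j], both of sum zero.
    Every point has a threshold that is constant on the box, so its term vanishes; of the area term
    only the part in [i * j] survives. *)
Lemma empty_box_sum r s t : (r <= k)%N -> empty_box r s t ->
  block_sum (2 * lx r) s (fun i => block_sum (2 * ly r) t (fun j =>
    grid_discrepancy i j * (wave R (lx r) i * (wave R (ly r) j * C r i j)))) =
  - (N%:R * delta ^+ 2 * (lx r)%:R ^+ 2 *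
     block_sum (2 * ly r) t (fun j => wave R (ly r) j * (j%:R * C r (s * (2 * lx r)) j))).
Proof.
move=> rk empt; set i0 := (s * (2 * lx r))%N.
pose psi j := wave R (ly r) j * C r i0 j.
have psi0 : block_sum (2 * ly r) t psi = 0 by exact: riesz_wave0.
have wave0 : block_sum (2 * lx r) s (wave R (lx r)) = 0.
  rewrite -[RHS](subrr (lx r)%:R) -[X in X - X](mul1r) -{1}(block_sum_const _ (2 * s)).
  rewrite -(block_sum_const _ (2 * s).+1) -block_sum_wave.
  by apply: eq_block_sum => u _; rewrite mulr1.
rewrite (eq_block_sum (psi := fun i => block_sum (2 * ly r) t (fun j =>
    (N%:R * ((alpha - delta * i%:R) * wave R (lx r) i)) * ((beta - delta * j%:R) * psi j)
    - \sum_n (w n * ((i <= a n)%N%:R * wave R (lx r) i)) *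
       ((j <= b n)%N%:R * psi j)))); last first.
  move=> u ul; apply: eq_block_sum => v vl; rewrite riesz_box_block// -/i0.
  rewrite -/(psi _) /grid_discrepancy mulrBl mulr_suml; congr (_ - _); first by rewrite /psi; ring.
  by apply: eq_bigr => n _; rewrite /psi; ring.
under eq_block_sum_fun => i do rewrite block_sumB block_sum_bigsum.
rewrite block_sumB block_sum_bigsum block_sum_separate block_sumZ.
under eq_bigr do rewrite block_sum_separate block_sumZ.
rewrite [X in _ - X]big1 ?subr0; last first.
  move=> n _; move/forallP: empt => /(_ n); rewrite negb_and => /orP[an|bn].
    by rewrite (block_sum_threshold an)// mulr0 mul0r.
  by rewrite (block_sum_threshold bn)// mulr0.
have affine l l' g phi : block_sum l l' phi = 0 ->
    block_sum l l' (fun j => (g - delta * j%:R) * phi j) =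
    - (delta * block_sum l l' (fun j => phi j * j%:R)).
  move=> phi0; rewrite -[RHS]add0r -(mulr0 g) -phi0 -!block_sumZ -block_sumB.
  by apply: eq_block_sum => u _; ring.
rewrite !affine// wave_moment.
rewrite (eq_block_sum (psi := fun j => wave R (ly r) j * (j%:R * C r i0 j))).
  by ring.
by move=> u _; rewrite /psi; ring.
Qed.

Hypothesis c0 : 0 <= c.
Hypothesis c8 : c <= 8^-1.
Hypothesis ck : 2 * k.+1%:R * c ^+ 2 <= 1.

Lemma box_sum_ge r s t : (r <= k)%N ->
  (empty_box r s t)%:R * (N%:R * delta ^+ 2 * (2 ^ (2 * e + k))%:R ^+ 2 / 2) <=
  block_sum (2 * lx r) s (fun i => block_sum (2 * ly r) t (fun j =>
    grid_discrepancy i j * (riesz_factor e (box_sign i) r j * C r i j))).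
Proof.
move=> rk; have lr0 : (0 < 2 * lx r)%N by rewrite muln_gt0 expn_gt0.
rewrite (eq_block_sum (psi := fun i => (empty_box r s t)%:R *
    block_sum (2 * ly r) t (fun j => grid_discrepancy i j *
      (wave R (lx r) i * (wave R (ly r) j * C r i j))))); last first.
  move=> u ul; rewrite -block_sumZ; apply: eq_block_sum => v vl.
  by rewrite /riesz_factor /box_sign -/(ly r) !block_index//; ring.
rewrite block_sumZ; case: (boolP (empty_box r s t)) => [em|_]; last by rewrite !mul0r.
rewrite !mul1r empty_box_sum//.
(* Boxes of all levels contain equally many grid points, so the bound is the same for every [r]. *)
have -> : (2 ^ (2 * e + k))%:R = (lx r)%:R * (ly r)%:R :> R.
  by rewrite -natrM -expnD; congr (2 ^ _)%:R; lia.
have := @riesz_wave_moment R c e c0 (box_sign (s * (2 * lx r))) k.+1 r t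
  (box_sign_le1 _) ck c8 (leqW rk).
rewrite -/(ly r) -/(C r _); set S := block_sum _ _ _ => S_le.
have : 0 <= N%:R * delta ^+ 2 * (lx r)%:R ^+ 2 by rewrite mulr_ge0 ?sqr_ge0// mulr_ge0 ?sqr_ge0.
move: (N%:R * delta ^+ 2) => D; rewrite exprMn => D0.
nra.
Qed.

Lemma sum_indicator_le1 m x : \sum_(s < m) (x == s :> nat)%:R <= 1 :> R.
Proof.
have [xm|mx] := ltnP x m; last first.
  rewrite big1// => s _; rewrite (_ : (x == s :> nat) = false)//.
  by apply/negbTE; rewrite neq_ltn (leq_trans (ltn_ord s) mx) orbT.
rewrite (bigD1 (Ordinal xm))//= eqxx big1 ?addr0// => s.
by rewrite -val_eqE /= eq_sym => /negbTE ->.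
Qed.

(** Level [r] has 2^k boxes, and each point lies in at most one of them. *)
Lemma empty_box_count r : (r <= k)%N ->
  (2 ^ k)%:R - N%:R <=
  \sum_(s < 2 ^ r) \sum_(t < 2 ^ (k - r)) (empty_box r s t)%:R :> R.
Proof.
move=> rk.
pose hit n s t : R := (a n %/ (2 * lx r) == s)%N%:R * (b n %/ (2 * ly r) == t)%N%:R.
have one (s t : nat) : 1 - \sum_n hit n s t <= (empty_box r s t)%:R.
  case: (boolP (empty_box r s t)) => [_|].
    by rewrite gerBl sumr_ge0// => n _; rewrite mulr_ge0.
  rewrite negb_forall => /existsP[n]; rewrite negbK => /andP[as_ bt].
  rewrite subr_le0 (bigD1 n)//= {1}/hit as_ bt mulr1 lerDl.
  by rewrite sumr_ge0// => m _; rewrite mulr_ge0.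
apply: (@le_trans _ _ (\sum_(s < 2 ^ r) \sum_(t < 2 ^ (k - r)) (1 - \sum_n hit n s t)));
  last by apply: ler_sum => s _; apply: ler_sum => t _.
under eq_bigr do rewrite sumrB.
rewrite sumrB lerB//.
  rewrite !sumr_const !card_ord -mulrnA -expnD subnK//.
under eq_bigr do rewrite exchange_big/=.
rewrite exchange_big/= -[leRHS](_ : \sum_(n < N) 1 = _); last first.
  by rewrite sumr_const card_ord.
apply: ler_sum => n _.
under eq_bigr do rewrite -mulr_sumr.
rewrite -mulr_suml mulr_ile1 ?sum_indicator_le1 ?sumr_ge0//.
Qed.

Lemma level_sum_ge r : (r <= k)%N ->
  ((2 ^ k)%:R - N%:R) * (N%:R * delta ^+ 2 * (2 ^ (2 * e + k))%:R ^+ 2 / 2) <=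
  \sum_(i < M) \sum_(j < M)
    grid_discrepancy i j * (riesz_factor e (box_sign i) r j * C r i j).
Proof.
move=> rk.
have Mx : M = (2 ^ r * (2 * lx r))%N.
  by rewrite /M /lx -expnS -expnD; congr (2 ^ _)%N; lia.
have My : M = (2 ^ (k - r) * (2 * ly r))%N.
  by rewrite /M /ly -expnS -expnD; congr (2 ^ _)%N; lia.
rewrite (sum_blocks (fun i => \sum_(j < M) grid_discrepancy i j *
  (riesz_factor e (box_sign i) r j * C r i j)) Mx).
set V := N%:R * _ ^+ 2 * _ / 2.
have V0 : 0 <= V by rewrite mulr_ge0 ?invr_ge0// mulr_ge0 ?sqr_ge0// mulr_ge0 ?sqr_ge0.
apply: le_trans (ler_wpM2r V0 (empty_box_count rk)) _.
rewrite mulr_suml; apply: ler_sum => s _.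
under eq_block_sum_fun => i do rewrite (sum_blocks (fun j => grid_discrepancy _ j *
  (riesz_factor e (box_sign _) r j * C r _ j)) My).
rewrite block_sum_bigsum mulr_suml; apply: ler_sum => t _.
exact: box_sum_ge.
Qed.

(** Duality: the imaginary part is bounded by 2, and pairing with it splits into k + 1 sums, one for
    each level. *)
Theorem grid_discrepancy_sum_ge :
  c / 2 * k.+1%:R * (((2 ^ k)%:R - N%:R) *
    (N%:R * delta ^+ 2 * (2 ^ (2 * e + k))%:R ^+ 2 / 2)) <=
  \sum_(i < M) \sum_(j < M) `|grid_discrepancy i j|.
Proof.
set V := _ * (_ / 2).
have : c * k.+1%:R * V <= \sum_(i < M) \sum_(j < M)
    grid_discrepancy i j * (riesz c e (box_sign i) k.+1 j).1.
  have -> : \sum_(i < M) \sum_(j < M)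
      grid_discrepancy i j * (riesz c e (box_sign i) k.+1 j).1 =
    \sum_(r < k.+1) c * (\sum_(i < M) \sum_(j < M)
      grid_discrepancy i j * (riesz_factor e (box_sign i) r j * C r i j)).
    under [RHS]eq_bigr => r _ do rewrite mulr_sumr.
    rewrite [RHS]exchange_big; apply: eq_bigr => i _.
    under [RHS]eq_bigr => r _ do rewrite mulr_sumr.
    rewrite [RHS]exchange_big; apply: eq_bigr => j _.
    rewrite riesz_im_sum mulr_sumr; apply: eq_bigr => r _; rewrite /C; ring.
  rewrite -mulrA mulrC -mulrA -[k.+1 in leLHS]card_ord mulr_natl -sumr_const.
  by apply: ler_sum => r _; rewrite mulrC ler_wpM2l// level_sum_ge// -ltnS.
have : \sum_(i < M) \sum_(j < M)
    grid_discrepancy i j * (riesz c e (box_sign i) k.+1 j).1 <=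
    2 * \sum_(i < M) \sum_(j < M) `|grid_discrepancy i j|.
  rewrite mulr_sumr; apply: ler_sum => i _.
  rewrite mulr_sumr; apply: ler_sum => j _.
  apply: le_trans (ler_norm _) _; rewrite normrM mulrC ler_wpM2r//.
  exact: (riesz_im_le _ _ (box_sign_le1 i) ck).
lra.
Qed.

End Grid.

(** * Bounding integrals below by step functions *)

Section IntegralLowerBound.
Context d (T : measurableType d) (R : realType).
Variable mu : {measure set T -> \bar R}.

(** The integral of a nonnegative function is a supremum over simple functions below it, hence
    monotone even for integrands not known to be measurable, such as the inner integral as a
    function of [y]. *)
Lemma le_integral_restrict (D : set T) (f g : T -> \bar R) :
  (forall x, 0 <= g x)%E -> (forall x, D x -> 0 <= f x)%E ->
  (forall x, g x <= (f \_ D) x)%E ->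
  (\int[mu]_x g x <= \int[mu]_(x in D) f x)%E.
Proof.
move=> g0 f0 gf; rewrite ge0_integralTE// ge0_integralE//.
apply: le_ereal_sup => _ [h hg <-]; exists h => // x.
exact: le_trans (hg x) (gf x).
Qed.

Lemma integral_ge_sum (I : finType) (A : I -> set T) (h : I -> R) (v : R)
    (D : set T) (f : T -> \bar R) :
  (forall i, measurable (A i)) -> trivIset setT A ->
  (forall i, mu (A i) = v%:E) ->
  (forall x, D x -> 0 <= f x)%E ->
  (forall i x, A i x -> D x /\ ((h i)%:E <= f x)%E) ->
  ((v * \sum_i h i)%:E <= \int[mu]_(x in D) f x)%E.
Proof.
move=> mA tA Av f0 hf.
have v0 (i : I) : 0 <= v by rewrite -lee_fin -(Av i).
(* Cutting [h] off at 0 makes the step function nonnegative and can only increase its integral; [f]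
   still dominates it, being nonnegative on [D]. *)
pose g x := (\sum_i (Num.max 0 (h i))%:E * (\1_(A i) x)%:E)%E.
have term0 i x : (0 <= (Num.max 0 (h i))%:E * (\1_(A i) x)%:E)%E.
  by rewrite mule_ge0// lee_fin// le_max lexx.
have -> : (v * \sum_i h i)%:E = (\sum_i (v * h i)%:E)%E.
  by rewrite mulr_sumr sumEFin.
apply: (@le_trans _ _ (\int[mu]_x g x)%E).
  rewrite ge0_integral_sum//; last first.
    move=> i; apply: measurable_funeM; apply/measurable_EFinP.
    exact: measurable_indic.
  apply: lee_sum => i _.
  rewrite ge0_integralZl_EFin ?le_max ?lexx//; last first.
    by apply/measurable_EFinP; exact: measurable_indic.
  rewrite integral_indic// setIT Av -EFinM lee_fin mulrC ler_wpM2r ?(v0 i)//.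
  by rewrite le_max lexx orbT.
apply: le_integral_restrict => // [x|x]; first exact: sume_ge0.
have [[i Ai]|noA] := pselect (exists i, A i x); last first.
  rewrite /g big1 => [|i _]; first by rewrite /patch; case: ifPn => // /set_mem /f0.
  rewrite indicE memNset ?mule0// => Ai; apply: noA; by exists i.
have [Dx hx] := hf _ _ Ai.
rewrite patchT ?inE// /g (bigD1 i)//= indicE mem_set// mule1 big1 => [|j ji].
  by rewrite adde0 EFin_max ge_max hx f0.
rewrite indicE memNset ?mule0// => Aj.
by move: ji; rewrite (tA j i) ?eqxx//; exists x.
Qed.

End IntegralLowerBound.

(** * From grid values to the integral over lower corners in [0, 1/2)^2 *)

Section UnitSquare.
Variable R : realType.

Lemma lambda2_rectangle (a b c d : R) : a <= b -> c <= d ->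
  lambda2 (`[a, b[ `*` `[c, d[) = ((b - a) * (d - c))%:E.
Proof.
move=> ab cd; rewrite /lambda2 product_measure1E//=.
rewrite !lebesgue_measure_itv/= !lte_fin EFinM.
have H (x y : R) : x <= y -> (if x < y then (y%:E - x%:E)%E else 0%E) = (y - x)%:E.
  by case: ltgtP => // -> _; rewrite subrr.
by rewrite !H.
Qed.

Variables (N M : nat) (p : 'I_N -> R * R) (y : R * R).
Hypothesis p01 : forall n, halfopen_unit_square (p n).
Hypothesis M0 : (0 < M)%N.
Hypothesis y1 : 2^-1 <= y.1 <= 1.
Hypothesis y2 : 2^-1 <= y.2 <= 1.

Let delta : R := (2 * M%:R)^-1.
(** The [M] by [M] cells cover only [0, 1/2)^2, so the column [a n] and the row [b n] of a point may
    be [M] or more. *)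
Let a n := Num.truncn ((p n).1 / delta).
Let b n := Num.truncn ((p n).2 / delta).
Let w n : R := ((p n).1 < y.1)%R%:R * ((p n).2 < y.2)%R%:R.

Let cell_side i : set R := `[delta * i%:R, delta * i.+1%:R[.
Let cell (ij : 'I_M * 'I_M) : set (R * R) := cell_side ij.1 `*` cell_side ij.2.

Let M0R : 0 < M%:R :> R. Proof. by rewrite ltr0n. Qed.

Let delta0 : 0 < delta. Proof. by rewrite invr_gt0 mulr_gt0. Qed.

Let deltaM : delta * M%:R = 2^-1.
Proof. by rewrite /delta; field; rewrite gt_eqF. Qed.

Lemma cell_side_inj i j (x : R) : cell_side i x -> cell_side j x -> i = j.
Proof.
rewrite /cell_side /= !in_itv/= => /andP[il iu] /andP[jl ju].
have := le_lt_trans il ju; have := le_lt_trans jl iu.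
by rewrite !ltr_pM2l// !ltr_nat; lia.
Qed.

Lemma cell_side_half (i : 'I_M) (x : R) : cell_side i x -> 0 <= x <= 2^-1.
Proof.
rewrite /cell_side /= in_itv/= => /andP[il iu]; apply/andP; split.
  by apply: le_trans il; rewrite mulr_ge0// ltW.
apply/ltW/(lt_le_trans iu); rewrite -deltaM ler_pM2l// ler_nat.
exact: ltn_ord.
Qed.

(** Comparing [q] with [x] or with the left end of the cell of [x] can differ only if [q] lies in
    that same cell. *)
Lemma threshold_cell_side i (x q : R) : 0 <= q -> cell_side i x ->
  `|(x <= q)%R%:R - (i <= Num.truncn (q / delta))%N%:R| <=
  (Num.truncn (q / delta) == i)%:R :> R.
Proof.
move=> q0; rewrite /cell_side /= in_itv/= => /andP[il iu].
have le_trunc m : (m <= Num.truncn (q / delta))%N = (delta * m%:R <= q).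
  by rewrite truncn_ge_nat ?divr_ge0 ?(ltW delta0)// ler_pdivlMr// mulrC.
have [xq|qx] := leP x q.
  by rewrite le_trunc (le_trans il xq) subrr normr0.
have [|_] := leqP i (Num.truncn (q / delta)); last by rewrite subrr normr0.
rewrite leq_eqVlt => /predU1P[->|]; first by rewrite eqxx sub0r normrN normr1.
by rewrite le_trunc => /(lt_le_trans iu)/ltW/le_lt_trans/(_ qx); rewrite ltxx.
Qed.

Let corner := grid_discrepancy a b w y.1 y.2 delta.

Lemma local_discrepancy (x : R * R) : x.1 <= y.1 -> x.2 <= y.2 ->
  (`| (count_in p (box x y))%:R%:E - N%:R%:E * lambda2 (box x y) |)%E =
  `| N%:R * ((y.1 - x.1) * (y.2 - x.2)) -
     \sum_n w n * ((x.1 <= (p n).1)%R%:R * (x.2 <= (p n).2)%R%:R) |%:E.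
Proof.
move=> xy1 xy2; rewrite lambda2_rectangle// -EFinM -EFinB /= distrC.
congr (`| _ - _ |%:E); rewrite /count_in -sum1_card natr_sum big_mkcond /=.
apply: eq_bigr => n _; rewrite /w -!natrM !mulnb.
rewrite (_ : (n \in _) = ((p n).1 < y.1) && ((p n).2 < y.2) &&
  ((x.1 <= (p n).1) && (x.2 <= (p n).2))); last first.
  rewrite inE; apply/idP/idP.
    by move/set_mem => [/=]; rewrite !in_itv/= => /andP[-> ->] /andP[-> ->].
  by move=> /andP[/andP[h1 h2] /andP[h3 h4]]; apply/mem_set; split => /=;
    rewrite in_itv/= ?h1 ?h2 ?h3 ?h4.
by case: ifP.
Qed.

Lemma mul_dist_le (u v u' v' r : R) : 0 <= u <= 1 -> 0 <= v' <= 1 ->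
  `|u - u'| <= r -> `|v - v'| <= r -> `|u * v - u' * v'| <= 2 * r.
Proof.
move=> /andP[u0 u1] /andP[v0 v1] ur vr.
have -> : u * v - u' * v' = u * (v - v') + (u - u') * v' by ring.
rewrite mulr_natl mulr2n; apply: le_trans (ler_normD _ _) (lerD _ _).
  by rewrite normrM ger0_norm// (le_trans _ vr)// ler_piMl.
by rewrite normrM (ger0_norm v0) (le_trans _ ur)// ler_piMr.
Qed.

(** Moving [x] off the corner of its cell shifts each coordinate by at most [delta], which costs
    [2 * N * delta] in the area term. A point changes its contribution only if it shares the column
    or the row of the cell. *)
Lemma local_discrepancy_ge (ij : 'I_M * 'I_M) (x : R * R) : cell ij x ->
  `|corner ij.1 ij.2| - 2 * N%:R * delta -
    \sum_n ((a n == ij.1)%:R + (b n == ij.2)%:R) <=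
  `| N%:R * ((y.1 - x.1) * (y.2 - x.2)) -
     \sum_n w n * ((x.1 <= (p n).1)%R%:R * (x.2 <= (p n).2)%R%:R) |.
Proof.
case: ij => i j [/= xi xj].
rewrite lerBlDr lerBlDr -addrA -lerBlDl.
apply: le_trans (lerB_dist _ _) _; rewrite addrC.
rewrite /corner /grid_discrepancy.
set P := N%:R * _; set S := \sum_n _; set P' := N%:R * _; set S' := \sum_n _.
set E := \sum_n _.
have -> : P - S - (P' - S') = P - P' + (S' - S) by ring.
apply: le_trans (ler_normD _ _) _; apply: lerD.
  have := cell_side_half xi; have := cell_side_half xj.
  move: xi xj; rewrite /cell_side /= !in_itv/= -(natr1 i) -(natr1 j) => /andP[il iu] /andP[jl ju] /andP[xj0 xj1] /andP[xi0 xi1].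
  have /andP[y10 y11] := y1; have /andP[y20 y21] := y2.
  rewrite /P /P' -mulrBr normrM normr_nat -mulrA mulrCA ler_wpM2l//.
  have d0 := delta0; have di0 : 0 <= delta * i%:R by rewrite mulr_ge0// ltW.
  by apply: mul_dist_le; rewrite ?ler_norml; apply/andP; split; lra.
rewrite /S /S' -sumrB; apply: le_trans (ler_norm_sum _ _ _) _.
apply: ler_sum => n _; rewrite -mulrBr normrM.
have [/= h1 h2] := p01 n; move: h1 h2; rewrite !in_itv/= => /andP[p1 _] /andP[p2 _].
have := threshold_cell_side p1 xi; have := threshold_cell_side p2 xj.
rewrite -/(a n) -/(b n).
have : `|w n| <= 1 by rewrite /w -natrM mulnb normr_nat lern1 leq_b1.
move: (w n) (x.1 <= _) (x.2 <= _) (i <= _)%N (j <= _)%N => W b1 b2 b3 b4 W1 h1 h2.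
apply: (@le_trans _ _ `|b1%:R * b2%:R - b3%:R * b4%:R|).
  by rewrite ler_piMl.
apply: le_trans (lerD h2 h1).
by case: b1 b2 b3 b4 {h1 h2} => -[] [] [];
  rewrite /= ?(mulr0, mul0r, mulr1, subrr, subr0, sub0r, normrN, normr0, normr1);
  lra.
Qed.

(** The area errors add up to M^2 * 2 N delta = N M. Each point affects at most one column and one
    row of [M] cells, giving another 2 N M. *)
Lemma cell_sum_ge :
  \sum_(i < M) \sum_(j < M) `|corner i j| - 3 * N%:R * M%:R <=
  \sum_(ij : 'I_M * 'I_M) (`|corner ij.1 ij.2| - 2 * N%:R * delta -
    \sum_n ((a n == ij.1)%:R + (b n == ij.2)%:R)).
Proof.
rewrite !sumrB -(pair_big xpredT xpredT (fun i j : 'I_M => `|corner i j|))/=.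
rewrite -addrA lerD2l -opprD lerN2 sumr_const card_prod card_ord.
have -> : 3 * N%:R * M%:R = N%:R * M%:R + 2 * (N%:R * M%:R) :> R by ring.
apply: lerD.
  rewrite -[leLHS]mulr_natr natrM mulrA -(mulrA _ delta) deltaM.
  by rewrite (_ : 2 * N%:R / 2 = N%:R) //; field.
rewrite exchange_big/=.
have -> : 2 * (N%:R * M%:R) = \sum_(n < N) (M%:R + M%:R) :> R.
  by rewrite sumr_const card_ord -mulr_natl; ring.
apply: ler_sum => n _; rewrite big_split/=.
rewrite -(pair_big xpredT xpredT (fun i j : 'I_M => (a n == i)%:R : R))/=.
rewrite -(pair_big xpredT xpredT (fun i j : 'I_M => (b n == j)%:R : R))/=.
apply: lerD.
  rewrite exchange_big/= -[M in leRHS]card_ord -sumr_const.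
  by apply: ler_sum => i _; exact: sum_indicator_le1.
rewrite -[M in leRHS]card_ord -sumr_const.
by apply: ler_sum => i _; exact: sum_indicator_le1.
Qed.

Lemma inner_integral_ge :
  ((delta ^+ 2 * (\sum_(i < M) \sum_(j < M) `|corner i j|
     - 3 * N%:R * M%:R))%:E <=
   \int[@lambda2 R]_(x in [set x | closed_unit_square x /\ lec x y])
     `| (count_in p (box x y))%:R%:E - N%:R%:E * lambda2 (box x y) |)%E.
Proof.
have half1 : (2^-1 : R) <= 1 by lra.
apply: le_trans; last first.
  apply: (@integral_ge_sum _ _ _ (lebesgue_measure \x lebesgue_measure)%E _ cell
    (fun ij => `|corner ij.1 ij.2| - 2 * N%:R * delta -
      \sum_n ((a n == ij.1)%:R + (b n == ij.2)%:R)) (delta ^+ 2)).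
  - by move=> ij; apply: measurableX; exact: measurable_itv.
  - move=> [i j] [i' j'] _ _ [x [[/= xi xj] [/= xi' xj']]].
    by congr (_, _); apply/val_inj; [exact: cell_side_inj xi xi'|exact: cell_side_inj xj xj'].
  - move=> [i j]; rewrite [LHS]lambda2_rectangle ?ler_pM2l ?ler_nat//=.
    by rewrite -!natr1; congr (_%:E); ring.
  - by move=> x _; exact: abse_ge0.
  - move=> ij x xij; have [xi xj] := xij.
    have /andP[xi0 xi1] := cell_side_half xi; have /andP[xj0 xj1] := cell_side_half xj.
    have /andP[y10 y11] := y1; have /andP[y20 y21] := y2.
    have xy1 := le_trans xi1 y10; have xy2 := le_trans xj1 y20.
    split; last by rewrite local_discrepancy// lee_fin local_discrepancy_ge.
    split; last by rewrite /lec xy1.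
    by split => /=; rewrite in_itv/=; apply/andP; split => //; lra.
rewrite lee_fin ler_wpM2l ?sqr_ge0//; exact: cell_sum_ge.
Qed.

End UnitSquare.

(** * Choice of the parameters and integration over the upper corner *)

Lemma ln_nat_le_exponent (R : realType) (N k : nat) :
  (0 < N)%N -> (N <= 2 ^ k)%N -> ln (N%:R : R) <= k%:R.
Proof.
move=> N0 Nk; rewrite -[leRHS]expRK ler_ln ?posrE ?expR_gt0 ?ltr0n//.
apply: (@le_trans _ _ ((2 ^ k)%:R)); first by rewrite ler_nat.
rewrite natrX -[k%:R]mulr1 expRM_natl; apply: lerXn2r; rewrite ?nnegrE ?expR_ge0//.
(* This is 2 <= exp 1. *)
exact: (expR_ge1Dx 1).
Qed.

Lemma inner_integral_ge_ln (R : realType) (N : nat) (p : 'I_N -> R * R) (y : R * R) :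
  (0 < N)%N -> (forall n, halfopen_unit_square (p n)) ->
  2^-1 <= y.1 <= 1 -> 2^-1 <= y.2 <= 1 ->
  (((4 * 32 ^+ 3)^-1 * Num.sqrt (ln N%:R))%:E <=
   \int[@lambda2 R]_(x in [set x | closed_unit_square x /\ lec x y])
     `| (count_in p (box x y))%:R%:E - N%:R%:E * lambda2 (box x y) |)%E.
Proof.
(* This gives 2 N <= 2^k <= 4 N: at least half of the boxes are empty, while [N] stays comparable to
   their number. *)
move=> N0 p01 y1 y2; pose k := (up_log 2 N).+1.
have kl : (2 * N <= 2 ^ k)%N by rewrite expnS leq_pmul2l// up_logP.
have ku : (2 ^ k <= 4 * N)%N.
  rewrite /k; case: N N0 {p p01 kl k} => [//|[_|N _]]; first by rewrite up_log1.
  have := up_log_gtn (isT : (1 < 2)%N) (isT : (1 < N.+2)%N).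
  have : (0 < up_log 2 N.+2)%N by rewrite up_log_gt0.
  by case: (up_log 2 N.+2) => // m _ /=; rewrite !expnS; lia.
(* The lower bound sqrt (k + 1) / 2^16 for the main term does not depend on the offset [e], while
   the discretization error is at most 2^-e / 4. With [e = 15] the error is at most half of that
   bound. *)
pose M := (2 ^ (15 + k).+1)%N.
have M0 : (0 < M)%N by rewrite expn_gt0.
apply: le_trans (inner_integral_ge p01 M0 y1 y2); rewrite lee_fin.
set delta := (2 * M%:R)^-1.
set a := fun n => Num.truncn ((p n).1 / delta).
set b := fun n => Num.truncn ((p n).2 / delta).
set w := fun n => _ * _.
set S := \sum_(i < M) _.
pose s : R := Num.sqrt k.+1%:R.
have s2 : s ^+ 2 = k.+1%:R by rewrite sqr_sqrtr.
have s1 : 1 <= s by rewrite -[1]sqrtr1 ler_wsqrtr// ler1n.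
have ls : Num.sqrt (ln N%:R) <= s.
  rewrite ler_wsqrtr// (@ln_nat_le_exponent _ _ k.+1)//.
  by rewrite expnS; lia.
pose c : R := (8 * s)^-1.
have c0 : 0 <= c by rewrite invr_ge0; lra.
have c8 : c <= 8^-1 by rewrite lef_pV2 ?posrE; lra.
have ck : 2 * k.+1%:R * c ^+ 2 <= 1.
  have -> : 2 * k.+1%:R * c ^+ 2 = 32^-1 by rewrite -s2 /c; field; lra.
  lra.
have := grid_discrepancy_sum_ge 15 a b w y.1 y.2 delta c0 c8 ck.
rewrite -/M -/S -s2.
set K : R := (2 ^ k)%:R.
have K0 : 0 < K by rewrite ltr0n expn_gt0.
pose u : R := 32 ^+ 3.
have u0 : 0 < u by rewrite exprn_gt0.
have uE : (2 ^ 15)%:R = u by rewrite natrX /u -[15%N]/(5 * 3)%N exprM; congr (_ ^+ 3); ring.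
have MK : M%:R = 2 * u * K.
  by rewrite /M expnS expnD natrM natrM uE mulrA.
have EK : (2 ^ (2 * 15 + k))%:R = u ^+ 2 * K.
  by rewrite expnD natrM mulnC expnM natrX uE.
have NK : 2 * N%:R <= K by rewrite -natrM ler_nat.
have KN : K <= 4 * N%:R by rewrite -natrM ler_nat.
rewrite EK MK => main.
have dK : delta = (4 * u * K)^-1 by rewrite /delta MK; congr (_^-1); ring.
have {}main : s / (2 * u) <= delta ^+ 2 * S.
  apply: le_trans (ler_wpM2l (sqr_ge0 _) main).
  have -> : delta ^+ 2 * (c / 2 * s ^+ 2 * ((K - N%:R) *
      (N%:R * delta ^+ 2 * (u ^+ 2 * K) ^+ 2 / 2))) =
      s * ((K - N%:R) * N%:R / K ^+ 2 / (32 * 256)).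
    by rewrite dK /c; field; apply/and3P; split; apply: lt0r_neq0 => //; lra.
  rewrite ler_pM2l; last by lra.
  have -> : (2 * u)^-1 = 8^-1 / (32 * 256).
    by rewrite /u -invfM; congr (_^-1); ring.
  rewrite ler_pM2r; last by rewrite invr_gt0; lra.
  (* [N / K] lies in [1/4, 1/2], so (K - N) N / K^2 is at least 1/8. *)
  rewrite ler_pdivlMr ?exprn_gt0//; nra.
have err : delta ^+ 2 * (3 * N%:R * (2 * u * K)) <= (4 * u)^-1.
  have -> : delta ^+ 2 * (3 * N%:R * (2 * u * K)) = (4 * u)^-1 * (3 / 2 * (N%:R / K)).
    by rewrite dK; field; apply/andP; split; apply: lt0r_neq0.
  have : N%:R / K <= 2^-1 by rewrite ler_pdivrMr//; lra.
  by move=> ?; rewrite ler_piMr ?invr_ge0//; lra.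
have su : (4 * u)^-1 * s = s / (2 * u) - (4 * u)^-1 * s.
  by field; apply: lt0r_neq0.
have u4 : 0 < (4 * u)^-1 by rewrite invr_gt0; lra.
rewrite mulrBr -/u; apply: le_trans (lerB main err).
apply: (@le_trans _ _ ((4 * u)^-1 * s)); first by rewrite ler_pM2l.
by rewrite {1}su lerB// ler_peMr// ltW.
Qed.

Theorem theorem6 (R : realType) :
  exists2 c : R, 0 < c &
    forall (N : nat) (p : 'I_N -> R * R),
      (0 < N)%N ->
      injective p ->
      (forall n : 'I_N, halfopen_unit_square (p n)) ->
      ((c * Num.sqrt (ln N%:R))%:E <= extr_L1_discrepancy p)%E.
Proof.
(* The factor 1/4 is the area of the square [1/2, 1)^2 of upper corners; the rest is the constant of
   [inner_integral_ge_ln]. *)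
exists (4^-1 * (4 * 32 ^+ 3)^-1).
  by rewrite mulr_gt0 ?invr_gt0// mulr_gt0// exprn_gt0.
move=> N p N0 _ p01.
have half1 : (2^-1 : R) <= 1 by lra.
(* A single piece suffices, as the inner bound is uniform in [y]. *)
pose A (_ : unit) : set (R * R) := `[2^-1, 1[ `*` `[2^-1, 1[.
pose h : R := (4 * 32 ^+ 3)^-1 * Num.sqrt (ln N%:R).
have -> : 4^-1 * (4 * 32 ^+ 3)^-1 * Num.sqrt (ln N%:R) = 4^-1 * \sum_(i : unit) h.
  by rewrite sumr_const card_unit -mulrA.
apply: (@integral_ge_sum _ _ _ (lebesgue_measure \x lebesgue_measure)%E unit A (fun=> h)).
- by move=> i; apply: measurableX; exact: measurable_itv.
- by move=> [] [].
- by move=> i; rewrite [LHS]lambda2_rectangle//; congr (_%:E); lra.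
- by move=> y _; apply: integral_ge0 => x _; exact: abse_ge0.
- move=> i y [/=]; rewrite !in_itv/= => /andP[y10 /ltW y11] /andP[y20 /ltW y21].
  split; last by apply: inner_integral_ge_ln => //; apply/andP.
  by split => /=; rewrite in_itv/=; apply/andP; split => //; lra.
Qed.
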